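(* For any $\gamma \in (0,1/4)$ and any $p \in [1,\infty)$, there exist (a domain $\mathcal{X}$, a parameter set $\mathcal{R}$, and) function classes $\mathcal{F} = \{f_r \mid r \in \mathcal{R}\}$, $\mathcal{G} = \{g_r \mid r \in \mathcal{R}\} \subset [0,1]^{\mathcal{X}}$ with the following properties: (1) the dual class $\mathcal{G}^*$ $(\gamma,p)$-approximates the dual class $\mathcal{F}^*$; (2) the class $\mathcal{G}$ is statistically learnable; (3) the class $\mathcal{F}$ is not $\gamma$-statistically learnable.
   Context: $[0,1]^{\mathcal{X}}$ is the set of all functions $\mathcal{X} \to [0,1]$. Function classes are parameterized by a set $\mathcal{R} \subseteq \mathbb{R}^d$. For $x \in \mathcal{X}$ the dual functions $f_x^*, g_x^* : \mathcal{R} \to [0,1]$ are $f_x^*(r) = f_r(x)$, $g_x^*(r) = g_r(x)$; $\mathcal{F}^* = \{f_x^* \mid x \in \mathcal{X}\}$, $\mathcal{G}^* = \{g_x^* \mid x \in \mathcal{X}\}$. All dual functions are assumed integrable over $\mathcal{R}$. For $p \in [1,\infty)$, $\mathcal{G}^*$ $(\gamma,p)$-approximates $\mathcal{F}^*$ if for every $x \in \mathcal{X}$, $\left(\int_{\mathcal{R}} |f_x^*(r) - g_x^*(r)|^p \, dr\right)^{1/p} \leq \gamma$ (Lebesgue measure). A learning algorithm $\mathcal{A}$ takes as input a (finite) sample $\mathcal{S}$ of labeled examples in $\mathcal{X} \times [0,1]$ and returns a function $\mathcal{A}_{\mathcal{S}} : \mathcal{X} \to [0,1]$ (not necessarily in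 the class). For a distribution $\mathcal{D}$ over $\mathcal{X} \times [0,1]$ and $f : \mathcal{X} \to [0,1]$, $L_{\mathcal{D}}(f) = \mathbb{E}_{(x,y) \sim \mathcal{D}}[|f(x) - y|]$. For a class $\mathcal{H}$ of functions $\mathcal{X} \to [0,1]$ let $$\mathcal{V}_N(\mathcal{H}) = \inf_{\mathcal{A}} \sup_{\mathcal{D}} \mathbb{E}_{\mathcal{S} \sim \mathcal{D}^N}\left[L_{\mathcal{D}}(\mathcal{A}_{\mathcal{S}}) - \inf_{h \in \mathcal{H}} L_{\mathcal{D}}(h)\right],$$ with the infimum over learning algorithms and the supremum over distributions on $\mathcal{X} \times [0,1]$. $\mathcal{H}$ is statistically learnable if $\lim_{N \to \infty} \mathcal{V}_N(\mathcal{H}) = 0$, and $\gamma$-statistically learnable if $\lim_{N \to \infty} \mathcal{V}_N(\mathcal{H}) \leq \gamma$. *)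

(* Defs.v *)
From HB Require Import structures.
From mathcomp Require Import all_boot all_order all_algebra.
From mathcomp Require Import all_classical all_reals all_analysis.
From mathcomp Require Import measurable_realfun.

Set Implicit Arguments.
Unset Strict Implicit.
Unset Printing Implicit Defensive.

Import Order.TTheory GRing.Theory Num.Theory.
Import numFieldNormedType.Exports.

Local Open Scope classical_set_scope.
Local Open Scope ring_scope.

Section power_measure.
Context {d : measure_display} {T : measurableType d} {R : realType}.

Definition cons_pair n (z : T * n.-tuple T) : n.+1.-tuple T :=
  [tuple of z.1 :: z.2].

Lemma measurable_cons_pair n : measurable_fun setT (@cons_pair n).
Proof.
by apply: measurable_cons; [exact: measurable_fst|exact: measurable_snd].
Qed.

(* The n-fold product measure on n.-tuple T, which the library equips with the
   product sigma-algebra. *)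
Fixpoint power_measure (m : set T -> \bar R) (n : nat) :
    set (n.-tuple T) -> \bar R :=
  match n return set (n.-tuple T) -> \bar R with
  | 0%N => @dirac _ (0.-tuple T) [tuple] R
  | k.+1 => pushforward (m \x @power_measure m k)%E (@cons_pair k)
  end.
Arguments power_measure m n _ : clear implicits.

Let power_measure_props (m : {sigma_finite_measure set T -> \bar R}) n :
  [/\ power_measure m n set0 = 0%E,
      forall A, (0 <= power_measure m n A)%E,
      semi_sigma_additive (power_measure m n) &
      sigma_finite setT (power_measure m n)].
Proof.
elim: n => [|n [p0 pge0 psa psf]].
  split; first exact: measure0.
  - by move=> A; exact: measure_ge0.
  - exact: measure_semi_sigma_additive.
  - exact: sigma_finiteT.
pose M := isMeasure.Build _ _ _ (power_measure m n) p0 pge0 psa.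
pose mu1 : {measure set (n.-tuple T) -> \bar R} :=
  HB.pack (power_measure m n) M.
pose S := Measure_isSigmaFinite.Build _ _ _ mu1 psf.
pose mu : {sigma_finite_measure set (n.-tuple T) -> \bar R} :=
  HB.pack (power_measure m n) M S.
have mc A : measurable A -> measurable (@cons_pair n @^-1` A).
  by move=> mA; rewrite -[X in measurable X]setTI; exact: measurable_cons_pair measurableT _ mA.
have -> : power_measure m n.+1 = pushforward (m \x mu)%E (@cons_pair n) by [].
split.
- by rewrite /pushforward preimage_set0 measure0.
- by move=> A; rewrite /pushforward; exact: measure_ge0.
- move=> F mF tF mUF; rewrite /pushforward preimage_bigcup.
  apply: measure_semi_sigma_additive.
  + by move=> k; exact: mc.
  + apply/trivIsetP => /= i j _ _ ij; rewrite -preimage_setI.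
    by move/trivIsetP : tF => /(_ _ _ _ _ ij) ->//; rewrite preimage_set0.
  + by rewrite -preimage_bigcup; exact: mc.
- have /sigma_finiteP[F [TF ndF mF]] := sigma_finiteT m.
  have /sigma_finiteP[G [TG ndG mG]] := sigma_finiteT mu.
  pose u (t : n.+1.-tuple T) : T * n.-tuple T := (thead t, [tuple of behead t]).
  have mu_ : measurable_fun setT u.
    apply: measurable_fun_pair; last exact: measurable_behead.
    exact: measurable_tnth.
  exists (fun k => u @^-1` (F k `*` G k)).
    rewrite -preimage_bigcup (_ : \bigcup_k (F k `*` G k) = setT).
      by rewrite preimage_setT.
    rewrite -subTset => -[x y] _.
    have [i _ Fx] : (\bigcup_i F i) x by rewrite -TF.
    have [j _ Gy] : (\bigcup_i G i) y by rewrite -TG.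
    exists (maxn i j) => //; split => /=.
    - by move: x Fx; exact/subsetPset/ndF/leq_maxl.
    - by move: y Gy; exact/subsetPset/ndG/leq_maxr.
  move=> k; have [mFk Fk] := mF k; have [mGk Gk] := mG k.
  have mFG : measurable (F k `*` G k) by exact: measurableX.
  split; first by rewrite -[X in measurable X]setTI; exact: mu_.
  rewrite /pushforward -comp_preimage (_ : u \o _ = id); last first.
    rewrite funeqE => -[x t] /=.
    by rewrite /u /cons_pair/= theadE; congr pair; exact: val_inj.
  rewrite preimage_id (product_measure1E m mu)//.
  by rewrite lte_mul_pinfty// ge0_fin_numE.
Qed.

Section sigma_finite.
Variables (m : {sigma_finite_measure set T -> \bar R}) (n : nat).

Let pm0 : power_measure m n set0 = 0%E.
Proof. by case: (power_measure_props m n). Qed.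

Let pm_ge0 A : (0 <= power_measure m n A)%E.
Proof. by case: (power_measure_props m n). Qed.

Let pm_sigma_additive : semi_sigma_additive (power_measure m n).
Proof. by case: (power_measure_props m n). Qed.

HB.instance Definition _ := isMeasure.Build _ _ _ (power_measure m n)
  pm0 pm_ge0 pm_sigma_additive.

Let pm_sigma_finite : sigma_finite setT (power_measure m n).
Proof. by case: (power_measure_props m n). Qed.

HB.instance Definition _ := Measure_isSigmaFinite.Build _ _ _
  (power_measure m n) pm_sigma_finite.

End sigma_finite.

Lemma power_measure_box (m : {sigma_finite_measure set T -> \bar R}) n
    (A : 'I_n -> set T) : (forall i, measurable (A i)) ->
  power_measure m n [set t | forall i, A i (tnth t i)] =
  (\prod_(i < n) m (A i))%E.
Proof.
elim: n A => [|k IH] A mA /=.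
  by rewrite big_ord0 diracE mem_set// => -[].
have mB : measurable
    [set t : k.-tuple T | forall i, A (lift ord0 i) (tnth t i)].
  rewrite (_ : [set _ | _] = \bigcap_(i in [set: 'I_k])
      ((fun t : k.-tuple T => tnth t i) @^-1` A (lift ord0 i))).
    apply: fin_bigcap_measurable => // i _.
    by rewrite -[X in measurable X]setTI; apply: measurable_tnth.
  by apply/seteqP; split=> t /= H i; [move=> _|]; exact: H.
rewrite big_ord_recl -IH; last by move=> i; exact: mA.
rewrite -(product_measure1E m (power_measure m k))//.
rewrite /pushforward; congr (_ _).
apply/seteqP; split=> -[x t] /= H.
  split; first by have := H ord0.
  by move=> i; have := H (lift ord0 i); rewrite /cons_pair/= tnthS.
case: H => H0 H1 i.
case: (unliftP ord0 i) => [j ->|->]; last by [].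
by rewrite /cons_pair tnthS; exact: H1.
Qed.

Section probability.
Variables (P : probability T R) (n : nat).

Let pm_setT : power_measure P n setT = 1%E.
Proof.
elim: n => [|k IH]; first by rewrite /= diracT.
rewrite /= /pushforward preimage_setT -setXTT.
rewrite (@product_measure1E _ _ _ _ _ P (power_measure P k))//.
transitivity (P setT * power_measure P k setT)%E; first by [].
by rewrite IH mule1; exact: probability_setT.
Qed.

HB.instance Definition _ := Measure_isProbability.Build _ _ _
  (power_measure P n) pm_setT.

End probability.
End power_measure.
Arguments power_measure {d T R} m n _.

Definition lebesgue_Rn {R : realType} (n : nat) :
    set (n.-tuple (measurableTypeR R)) -> \bar R :=
  power_measure (@lebesgue_measure R) n.

HB.instance Definition _ (R : realType) n :=
  SigmaFiniteMeasure.on (@lebesgue_Rn R n).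

Section learning.
Context {d : measure_display} {X : measurableType d} {R : realType}.
Implicit Types (h : X -> R) (H : set (X -> R)).

(* A distribution on X * [0, 1] is a probability measure on X * R whose labels
   lie in [0, 1] almost surely. *)
Definition labeled_distribution : set (probability (X * R)%type R) :=
  [set D | D ([set: X] `*` `[0, 1]) = 1%E].

Definition risk (D : probability (X * R)%type R) h : \bar R :=
  (\int[D]_z `|h z.1 - z.2|%:E)%E.

(* The measurability conditions are those under which the two expectations in
   the definition of [minimax_regret] make sense; nothing more is required of a
   learning algorithm. *)
Definition learning_algorithm : set (seq (X * R) -> X -> R) :=
  [set A : seq (X * R) -> X -> R |
    [/\ forall S x, 0 <= A S x <= 1,
        forall S, measurable_fun setT (A S) &
        forall N D, labeled_distribution D ->
          measurable_fun setT
            (fun S : N.-tuple (X * R)%type => risk D (A S))]].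

Definition minimax_regret H (N : nat) : \bar R :=
  ereal_inf [set ereal_sup
    [set (\int[power_measure D N]_S
            (risk D (A (tval S)) - ereal_inf [set risk D h | h in H]))%E
    | D in labeled_distribution]
  | A in learning_algorithm].

Definition statistically_learnable H : Prop :=
  minimax_regret H n @[n --> \oo] --> 0%E.

(* The limit always exists for a class of measurable functions: an algorithm
   may ignore examples, so that [minimax_regret H] is nonincreasing. *)
Definition gamma_statistically_learnable (gamma : R) H : Prop :=
  exists2 l : \bar R, minimax_regret H n @[n --> \oo] --> l & (l <= gamma%:E)%E.

End learning.

Section dual_classes.
Context {d : measure_display} {X : measurableType d} {R : realType}.
Variables (n : nat) (P : set (n.-tuple (measurableTypeR R))).
Implicit Types f g : n.-tuple (measurableTypeR R) -> X -> R.

Definition function_class f : set (X -> R) := [set f r | r in P].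

Definition dual f (x : X) : n.-tuple (measurableTypeR R) -> R := fun r => f r x.

Definition parameterized_family f : Prop :=
  [/\ forall r, P r -> forall x, 0 <= f r x <= 1,
      forall r, P r -> measurable_fun setT (f r) &
      forall x, (@lebesgue_Rn R n).-integrable P (EFin \o dual f x)].

Definition dual_approximates (gamma p : R) f g : Prop :=
  forall x, ((\int[@lebesgue_Rn R n]_(r in P)
                (`|dual f x r - dual g x r| `^ p)%:E) `^ p^-1 <= gamma%:E)%E.

End dual_classes.

(* Main.v *)
Require Import Defs.
From HB Require Import structures.
From mathcomp Require Import all_boot all_order all_algebra.
From mathcomp Require Import all_classical all_reals all_analysis.
From mathcomp Require Import measurable_realfun.
From mathcomp Require Import lra zify.

Set Implicit Arguments.
Unset Strict Implicit.
Unset Printing Implicit Defensive.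

Import Order.TTheory GRing.Theory Num.Theory.
Import numFieldNormedType.Exports.

Local Open Scope classical_set_scope.
Local Open Scope ring_scope.

(** The parameter space is the whole real line.  The function f_r vanishes
    unless r is a natural number, in which case it is the 0/1-valued function on
    nat whose finite support is coded by r; g_r is always 0.  Since nat is a null
    set, the dual functions agree almost everywhere, and {g_r} is a singleton,
    hence learnable.  But {f_r} shatters every finite set of points, so the
    no-free-lunch argument bounds its minimax regret below by 1/4. *)

(** * Uniform probability measures on finite lists of points *)

Section uniform_measure.
Context {d : measure_display} {T : measurableType d} {R : realType}.
Variables (pt : nat -> T) (k : nat).

(** Points among [pt 0], ..., [pt k] may coincide and then count with multiplicity; taking [k.+1] of
    them keeps the normalization nonzero. *)
Definition uniform_on : set T -> \bar R :=
  mscale ((k.+1%:R : R)^-1)%:nng (msum (fun i => \d_(pt i)) k.+1).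

HB.instance Definition _ := Measure.on uniform_on.

Lemma uniform_on_eq1 (A : set T) : (forall i, A (pt i)) -> uniform_on A = 1%E.
Proof.
move=> Apt; rewrite /uniform_on /mscale/= /msum.
rewrite (eq_bigr (fun=> 1%E)) => [|i _]; last by rewrite /= diracE mem_set.
by rewrite sumEFin sumr_const card_ord -EFinM mulVf// pnatr_eq0.
Qed.

Let uniform_on_setT : uniform_on setT = 1%E.
Proof. exact: uniform_on_eq1. Qed.

HB.instance Definition _ :=
  Measure_isProbability.Build _ _ _ uniform_on uniform_on_setT.

Lemma integral_uniform_on (f : T -> \bar R) :
    measurable_fun setT f -> (forall x, 0 <= f x)%E ->
  (\int[uniform_on]_x f x =
   (k.+1%:R^-1)%:E * \sum_(i < k.+1) f (pt i))%E.
Proof.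
move=> mf f0; rewrite ge0_integral_mscale//= ge0_integral_measure_sum//.
congr (_ * _)%E; apply: eq_bigr => i _.
by rewrite integral_dirac// diracT mul1e.
Qed.

End uniform_measure.

(** * Integration against power measures, one coordinate at a time *)

Section power_integral.
Context {d : measure_display} {T : measurableType d} {R : realType}.

Lemma integral_power_measure0 (m : {sigma_finite_measure set T -> \bar R})
    (f : 0.-tuple T -> \bar R) : measurable_fun setT f ->
  (\int[power_measure m 0]_t f t = f [tuple])%E.
Proof. by move=> mf; rewrite /= integral_dirac// diracT mul1e. Qed.

Lemma integral_power_measureS (m : {sigma_finite_measure set T -> \bar R}) n
    (f : n.+1.-tuple T -> \bar R) :
    measurable_fun setT f -> (forall t, 0 <= f t)%E ->
  (\int[power_measure m n.+1]_t f t =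
   \int[m]_x \int[power_measure m n]_t f [tuple of x :: t])%E.
Proof.
move=> mf f0; have mc := @measurable_cons_pair d T n.
rewrite /= ge0_integral_pushforward// preimage_setT.
rewrite (@fubini_tonelli1 _ _ _ _ _ m (power_measure m n)) => [|//|x /=].
- by [].
- exact: measurableT_comp.
- exact: f0.
Qed.

(** Each integral is an average over index tuples [s], whose law does not depend on [b]. The indices
    can thus be drawn first, and a bound on the sum over [b] for each fixed [s] survives
    averaging. *)
Lemma sum_integral_uniform_power_ge (I : finType) (pt : I -> nat -> T) k n
    (F : I -> n.-tuple T -> \bar R) (c : \bar R) :
    (forall b, measurable_fun setT (F b)) -> (forall b t, 0 <= F b t)%E ->
    (forall s : n.-tuple 'I_k.+1,
      c <= \sum_b F b [tuple of map (pt b \o val) s])%E ->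
  (c <= \sum_b \int[power_measure (uniform_on (pt b) k) n]_t F b t)%E.
Proof.
elim: n F => [|n IH] F mF F0 Fc.
  apply: (le_trans (Fc [tuple])); apply: lee_sum => b _.
  by rewrite integral_power_measure0// [X in F b X]tuple0.
have mFi b x : measurable_fun setT (fun t : n.-tuple T => F b [tuple of x :: t]).
  apply: (@measurableT_comp _ _ _ _ _ _ (F b)) => //.
  by apply: measurable_cons.
have mint b : measurable_fun setT (fun x =>
    \int[power_measure (uniform_on (pt b) k) n]_t F b [tuple of x :: t])%E.
  have mc := @measurable_cons_pair d T n.
  apply: (@measurable_fun_fubini_tonelli_F _ _ _ _ _
    (power_measure (uniform_on (pt b) k) n) (F b \o @cons_pair _ _ n)) => //=.
  exact: measurableT_comp.
(* Split off the first draw and move its index outside the sum over [b], so that the induction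
   hypothesis applies for each index. *)
have -> : (\sum_b \int[power_measure (uniform_on (pt b) k) n.+1]_t F b t =
   (k.+1%:R^-1)%:E * \sum_(i < k.+1)
     \sum_b \int[power_measure (uniform_on (pt b) k) n]_t
        F b [tuple of pt b i :: t])%E.
  rewrite exchange_big/= ge0_sume_distrr//; last first.
    by move=> b _; apply: sume_ge0 => i _; apply: integral_ge0 => t _; exact: F0.
  apply: eq_bigr => b _.
  rewrite integral_power_measureS// integral_uniform_on//; first exact: mint.
  by move=> x; apply: integral_ge0 => t _; exact: F0.
have -> : c = ((k.+1%:R^-1)%:E * \sum_(i < k.+1) c)%E.
  have -> : (\sum_(i < k.+1) c = k.+1%:R%:E * c)%E.
    by rewrite sumr_const card_ord; apply/esym; exact: mule_natl.
  by rewrite muleA -EFinM mulVf ?mul1e// pnatr_eq0.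
apply: lee_wpmul2l; first by rewrite lee_fin.
apply: lee_sum => i _; apply: IH => //.
move=> s; apply: (le_trans (Fc [tuple of i :: s])).
by apply: lee_sum => b _; rewrite le_eqVlt; apply/orP; left;
  apply/eqP; congr (F b _); exact: val_inj.
Qed.

End power_integral.

(** * The no-free-lunch lower bound on the minimax regret *)

Section no_free_lunch.
Context {d : measure_display} {X : measurableType d} {R : realType}.
Lemma measurable_loss (h : X -> R) : measurable_fun setT h ->
  measurable_fun setT (fun z : X * R => `|h z.1 - z.2|%:E).
Proof.
move=> mh; apply/measurable_EFinP; apply: measurableT_comp => //.
apply: measurable_funB; last exact: measurable_snd.
by apply: measurableT_comp => //; exact: measurable_fst.
Qed.

Lemma risk_ge0 (D : probability (X * R)%type R) h : (0 <= risk D h)%E.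
Proof. by apply: integral_ge0 => z _; rewrite lee_fin. Qed.

Lemma ereal_inf_risk0 (D : probability (X * R)%type R) (H : set (X -> R)) h :
  H h -> risk D h = 0%E -> ereal_inf [set risk D h' | h' in H] = 0%E.
Proof.
move=> Hh rh; apply/eqP; rewrite eq_le; apply/andP; split.
  by apply: ereal_inf_lbound; exists h.
by apply: le_ereal_inf_tmp => _ [h' _ <-]; exact: risk_ge0.
Qed.

Variable x : nat -> X.

(** [inord] extends the labeling to all of [nat], as [uniform_on] expects a sequence; only indices
    up to [k] matter. *)
Definition labeled_point k (b : {ffun 'I_k.+1 -> bool}) (i : nat) : X * R :=
  (x i, (b (inord i))%:R).

Definition flip k (i : 'I_k.+1) (b : {ffun 'I_k.+1 -> bool}) :=
  [ffun j => b j (+) (j == i)].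

Lemma flipK k (i : 'I_k.+1) : involutive (flip i).
Proof. by move=> b; apply/ffunP => j; rewrite !ffunE addbK. Qed.

Lemma risk_uniform_on k (b : {ffun 'I_k.+1 -> bool}) h :
  measurable_fun setT h ->
  risk (uniform_on (labeled_point b) k) h =
  (k.+1%:R^-1 * \sum_(i < k.+1) `|h (x i) - (b i)%:R|)%:E.
Proof.
move=> mh; rewrite /risk integral_uniform_on//; last exact: measurable_loss.
rewrite EFinM -sumEFin; congr (_ * _)%E; apply: eq_bigr => i _ /=.
by rewrite inord_val.
Qed.

Lemma labeled_distribution_uniform k (b : {ffun 'I_k.+1 -> bool}) :
  labeled_distribution (uniform_on (labeled_point b) k).
Proof.
apply: uniform_on_eq1 => i; split => //=.
by rewrite in_itv/=; case: (b _); rewrite ?lexx ?ler01.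
Qed.

(** Pair [b] with [flip i b]. Both give the same sample, hence the same prediction at [x i], while
    their labels there are 0 and 1; by the triangle inequality the two losses add up to at least
    1. *)
Lemma sum_loss_unseen k n (a : seq (X * R) -> X -> R) (s : n.-tuple 'I_k.+1)
    (i : 'I_k.+1) : i \notin s ->
  #|{ffun 'I_k.+1 -> bool}|%:R / 2 <=
  \sum_b `|a (map (labeled_point b \o val) s) (x i) - (b i)%:R|.
Proof.
move=> si.
pose f (b : {ffun 'I_k.+1 -> bool}) :=
  `|a (map (labeled_point b \o val) s) (x i) - (b i)%:R|.
rewrite -[leRHS]/(\sum_b f b).
have ff b : 1 <= f b + f (flip i b).
  rewrite /f (_ : map (labeled_point (flip i b) \o val) s =
                  map (labeled_point b \o val) s); last first.
    apply/eq_in_map => j js /=; congr (_, _).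
    rewrite ffunE inord_val; case: eqP => [ji|_]; last by rewrite addbF.
    by rewrite -ji js in si.
  rewrite ffunE eqxx addbT distrC; set y := a _ _.
  apply: le_trans (ler_distD y _ _).
  by case: (b i); rewrite ?(subr0, sub0r, normrN) normr1.
rewrite ler_pdivrMr// mulr_natr mulr2n.
rewrite {2}(reindex_inj (inv_inj (@flipK k i)))/= -big_split/=.
rewrite -sum1_card natr_sum; exact: ler_sum.
Qed.

Lemma sum_empirical_loss_ge k n (a : seq (X * R) -> X -> R)
    (s : n.-tuple 'I_k.+1) : (n.*2 <= k)%N ->
  #|{ffun 'I_k.+1 -> bool}|%:R / 4 <=
  \sum_b (k.+1%:R^-1 * \sum_(i < k.+1)
    `|a (map (labeled_point b \o val) s) (x i) - (b i)%:R|).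
Proof.
move=> nk; rewrite -mulr_sumr exchange_big/= ler_pdivlMl//.
set c := #|_|%:R.
apply: (@le_trans _ _ (\sum_(i < k.+1 | i \notin s) (c / 2))).
  have sC : (#|s| + #|[pred i | i \notin s]| = k.+1)%N.
    by have := cardC (mem s); rewrite card_ord.
  have sn : (#|s| <= n)%N by rewrite -[leqRHS](size_tuple s) card_size.
  rewrite sumr_const -[leRHS]mulr_natr; set u := (X in _ <= _ * X).
  (* At least half of the [k.+1] indices are unseen, whence the second factor 1/2. *)
  have ks : (k < 2 * #|[pred i | i \notin s]|)%N by lia.
  have : k.+1%:R <= 2 * u by rewrite /u -natrM ler_nat; exact: ks.
  have : 0 <= c by rewrite /c.
  by move: c u => c u; nra.
rewrite [leRHS](bigID (fun i => i \in s))/= -[leLHS]add0r lerD//.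
  by apply: sumr_ge0 => i _; exact: sumr_ge0.
by apply: ler_sum => i; exact: sum_loss_unseen.
Qed.

(* Draw the labels of 2N+1 shattered points uniformly: at least half of the
   points are unseen in the sample, and on each of these the expected loss is at
   least 1/2. *)
Lemma minimax_regret_ge_quarter (H : set (X -> R)) N :
    (forall k (b : {ffun 'I_k.+1 -> bool}), exists2 h, H h &
      measurable_fun setT h /\ forall i : 'I_k.+1, h (x i) = (b i)%:R) ->
  ((4^-1)%:E <= minimax_regret H N)%E.
Proof.
move=> shat; apply: le_ereal_inf_tmp => _ [A [A01 mA mrisk] <-].
pose k := N.*2.
pose D (b : {ffun 'I_k.+1 -> bool}) : probability (X * R)%type R :=
  uniform_on (labeled_point b) k.
(* By shattering, some hypothesis fits the labeling exactly, so regret equals risk. *)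
have inf0 (b : {ffun 'I_k.+1 -> bool}) :
    ereal_inf [set risk (D b) h | h in H] = 0%E.
  have [h Hh [mh hb]] := shat k b; apply: (@ereal_inf_risk0 _ _ h) => //.
  rewrite risk_uniform_on// big1 ?mulr0// => i _.
  by rewrite hb subrr normr0.
set sup := ereal_sup _.
have le_sup b : (\int[power_measure (D b) N]_S risk (D b) (A (tval S)) <= sup)%E.
  apply: ereal_sup_ubound; exists (D b).
    exact: labeled_distribution_uniform.
  by apply: eq_integral => S _; rewrite inf0 sube0.
have : ((#|{ffun 'I_k.+1 -> bool}|%:R / 4)%:E <=
    \sum_(b : {ffun 'I_k.+1 -> bool})
      \int[power_measure (D b) N]_S risk (D b) (A (tval S)))%E.
  apply: sum_integral_uniform_power_ge.
  - by move=> b; apply: mrisk; exact: labeled_distribution_uniform.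
  - by move=> b t; exact: risk_ge0.
  - move=> s; under eq_bigr do rewrite risk_uniform_on//.
    by rewrite sumEFin lee_fin; exact: sum_empirical_loss_ge.
(* The supremum over distributions dominates the average over labelings. *)
move=> /le_trans /(_ (lee_sum _ (fun b _ => le_sup b))).
have -> : (\sum_(b : {ffun 'I_k.+1 -> bool}) sup =
           #|{ffun 'I_k.+1 -> bool}|%:R%:E * sup)%E.
  by rewrite sumr_const; apply/esym; exact: mule_natl.
rewrite EFinM lee_pmul2l// ?lte_fin ?ltr0n.
by apply/card_gt0P; exists [ffun=> false].
Qed.

End no_free_lunch.

(** * Learnability of a singleton class *)

Section singleton_class.
Context {d : measure_display} {X : measurableType d} {R : realType}.

Lemma risk_fin_num (D : probability (X * R)%type R) (h : X -> R) :
    labeled_distribution D -> measurable_fun setT h ->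
    (forall x, 0 <= h x <= 1) ->
  risk D h \is a fin_num.
Proof.
move=> D1 mh h01; have mI : measurable ([set: X] `*` `[0 : R, 1]).
  exact: measurableX.
rewrite ge0_fin_numE ?risk_ge0//; apply: (@le_lt_trans _ _ 1%E); last exact: ltry.
rewrite -(@probability_setT _ _ _ D) -[leRHS]mul1e -integral_cst//.
apply: ae_ge0_le_integral => //.
  exact: (measurable_loss mh).
(* The loss can exceed 1 only where the label leaves [0, 1], a null set. *)
exists (~` ([set: X] `*` `[0 : R, 1])); split.
- exact: measurableC.
- have := probability_setC D mI; rewrite [D (_ `*` _)]D1 subee// => ->; by [].
apply: subsetC => -[x y] [_ /=]; rewrite in_itv/= => /andP[y0 y1] _.
by rewrite lee_fin; have /andP[h0 h1] := h01 x; rewrite ler_norml; lra.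
Qed.

(** The regret is 0 for every sample size: always answering [h] achieves 0, and the point mass at
    [(x0, h x0)], where [h] has no risk, prevents a negative value. *)
Lemma statistically_learnable1 (x0 : X) (h : X -> R) :
    measurable_fun setT h -> (forall x, 0 <= h x <= 1) ->
  statistically_learnable [set h].
Proof.
move=> mh h01; rewrite /statistically_learnable.
suff -> : minimax_regret [set h] = cst 0%E by exact: cvg_cst.
apply/funext => N /=; apply/eqP; rewrite eq_le; apply/andP; split.
  apply: ge_ereal_inf; eexists.
    exists (fun=> h); last by [].
    by split => // n D _; exact: measurable_cst.
  apply: ge_ereal_sup => _ [D D1 <-].
  rewrite image_set1 ereal_inf1 integral0_eq// => S _.
  by rewrite subee// risk_fin_num.
apply: le_ereal_inf_tmp => _ [A [A01 mA mrisk] <-].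
pose D : probability (X * R)%type R := \d_(x0, h x0).
have Dh : risk D h = 0%E.
  rewrite /risk integral_dirac//=; last exact: (measurable_loss mh).
  by rewrite subrr normr0 mule0.
apply: le_ereal_sup_tmp; eexists.
  exists D; last by [].
  rewrite /labeled_distribution/= diracE mem_set//; split => //=.
  by rewrite in_itv/= h01.
apply: integral_ge0 => S _; rewrite image_set1 ereal_inf1 Dh sube0.
exact: risk_ge0.
Qed.

End singleton_class.

(** * Null sets of parameters that code finite bit strings *)

Section coded_bits.
Context {R : realType}.

(* The nat codes of the finite bit strings whose bit x is 1. *)
Definition codes (x : nat) : set R :=
  [set k%:R | k in [set k | nth false (odflt [::] (@unpickle (seq bool) k)) x]].

Definition code_set n (x : nat) : set (n.-tuple (measurableTypeR R)) :=
  [set t | forall i, codes x (tnth t i)].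

Lemma countable_codes (x : nat) : countable (codes x).
Proof. by apply: card_le_trans (card_image_le _ _) _; exact: countableP. Qed.

Lemma measurable_codes (x : nat) :
  measurable (codes x : set (measurableTypeR R)).
Proof.
by apply: countable_measurable (countable_codes x) => t; exact: measurable_set1.
Qed.

Lemma measurable_code_set n x : measurable (@code_set n x).
Proof.
rewrite (_ : @code_set n x = \bigcap_(i in [set: 'I_n])
    ((fun t : n.-tuple (measurableTypeR R) => tnth t i) @^-1`
      codes x)).
  apply: fin_bigcap_measurable => // i _.
  rewrite -[X in measurable X]setTI; apply: measurable_tnth => //.
  exact: measurable_codes.
by apply/seteqP; split=> t /= H i; [move=> _|]; exact: H.
Qed.

(** A box with a countable, hence null, side; the dimension is positive because an empty product
    would be 1. *)
Lemma lebesgue_code_set n x : lebesgue_Rn (@code_set n.+1 x) = 0%E.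
Proof.
transitivity (\prod_(i < n.+1) @lebesgue_measure R (codes x))%E.
  exact: (power_measure_box _ (fun=> measurable_codes x)).
by rewrite big_ord_recl countable_lebesgue_measure0 ?mul0e//; exact: countable_codes.
Qed.

Lemma indic_code_set (s : seq bool) (x : nat) :
  \1_(@code_set 1 x) [tuple (pickle s)%:R] = (nth false s x)%:R :> R.
Proof.
rewrite indicE; congr (_%:R); congr nat_of_bool.
apply/idP/idP => [/set_mem /(_ ord0)[k]|sx].
  move=> + /eqP; rewrite eqr_nat => + /eqP kE.
  by rewrite kE /mkset pickleK.
by apply: mem_set => i; exists (pickle s); rewrite ?ord1// /mkset pickleK.
Qed.

End coded_bits.

Theorem theoremB13 (R : realType) (gamma p : R) :
  0 < gamma < 1 / 4 -> 1 <= p ->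
  exists (disp : measure_display) (X : measurableType disp) (n : nat)
         (P : set (n.-tuple (measurableTypeR R)))
         (f g : n.-tuple (measurableTypeR R) -> X -> R),
    (0 < n)%N /\ measurable P /\
    parameterized_family P f /\ parameterized_family P g /\
    dual_approximates P gamma p f g /\
    statistically_learnable (function_class P g) /\
    ~ gamma_statistically_learnable gamma (function_class P f).
Proof.
move=> /andP[g0 g4] p1.
have p0 : p != 0 by rewrite gt_eqF// (lt_le_trans ltr01).
(* This gives both the integrability of the dual functions and their approximation by 0. *)
have int0 x : (\int[@lebesgue_Rn R 1]_r (\1_(@code_set R 1 x) r)%:E = 0)%E.
  rewrite integral_indic ?setIT//; last exact: measurable_code_set.
  exact: lebesgue_code_set.
exists _, nat, 1%N, setT, (fun r x => \1_(@code_set R 1 x) r), (fun _ _ => 0).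
split=> //; split=> //; split; [|split; [|split; [|split]]].
- split => //.
  + by move=> r _ x; rewrite indicE; case: (_ \in _); rewrite ?lexx ?ler01.
  + move=> x; apply/integrableP; split.
      apply/measurable_EFinP; exact: (measurable_indic (@measurable_code_set R 1 x)).
    under eq_integral do rewrite /dual/= ger0_norm//.
    by rewrite int0.
- split => //.
  + by move=> r _ x; rewrite lexx ler01.
  + by move=> x; exact: integrable0.
- move=> x; under eq_integral => r _.
    rewrite /dual subr0 ger0_norm//.
    (* An indicator equals its [p]-th power, as [p] is nonzero. *)
    rewrite (_ : _ `^ p = \1_(@code_set R 1 x) r); last first.
      by rewrite indicE; case: (_ \in _); rewrite ?powR1// powR0.
    over.
  by rewrite int0 poweR0r ?invr_eq0// lee_fin ltW.
- rewrite (_ : function_class _ _ = [set (fun=> 0)]).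
    by apply: (statistically_learnable1 0%N) => // x; rewrite lexx ler01.
  apply/seteqP; split=> [_ [r _ <-]//|_ ->]; by exists [tuple 0].
(* The bound 1/4 holds for every sample size, so it passes to the limit. *)
- move=> [l lim lg]; have : ((4^-1)%:E <= gamma%:E :> \bar R)%E.
    apply: le_trans lg; apply: cvge_ge lim; apply: nearW => N.
    apply: (@minimax_regret_ge_quarter _ _ _ id) => k b.
    (* The labeling written as a bit string; its code is the parameter realizing [b]. *)
    set s := mkseq (fun i => b (inord i)) k.+1.
    exists (fun x => \1_(@code_set R 1 x) [tuple (pickle s)%:R]).
      by exists [tuple (pickle s)%:R].
    split => // i; rewrite indic_code_set nth_mkseq//.
    by rewrite inord_val.
  by rewrite lee_fin; lra.
Qed.
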